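(* Let $d\ge 1$, $n\ge 1$, and let $f(z)=\sum_{k=0}^n c_k e^{\langle\lambda_k,z\rangle}$, $z\in\mathbb{C}^d$, be an exponential sum with $c_k\in\mathbb{C}\setminus\{0\}$ and pairwise distinct $\lambda_0,\dots,\lambda_n\in\mathbb{R}^d$. Let $\mu=\mu(\Lambda)=\min_{j\neq k}|\lambda_j-\lambda_k|$ be the minimal Euclidean distance between two points of the support set $\Lambda=\{\lambda_0,\dots,\lambda_n\}$. Let $\delta$ be a real number with $$\delta\ \ge\ \frac{d\sqrt{d}}{\mu}\,2\,\log\big(2+\sqrt{3}\big).$$ If $x\in\mathbb{R}^d$ is of Euclidean distance at least $\delta$ from the Archimedean tropical variety $\mathscr{T}(f)$, then $x\in\mathbb{R}^d\setminus\mathscr{A}(f)$, where $\mathscr{A}(f)$ is the amoeba of $f$.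
   Context: For $\lambda\in\mathbb{R}^d$ and $z\in\mathbb{C}^d$, $\langle\lambda,z\rangle=\sum_j\lambda_j z_j$ (bilinear), and $|\cdot|$ is the Euclidean norm on $\mathbb{R}^d$. The amoeba of $f$ is $\mathscr{A}(f)=\{\Re(z) : z\in\mathbb{C}^d,\ f(z)=0\}\subset\mathbb{R}^d$, where $\Re$ is the componentwise real part. The Archimedean tropical variety $\mathscr{T}(f)\subset\mathbb{R}^d$ is the tropical variety of $\hat f(x)=\max_{k=0,\dots,n}\left(\log|c_k|+\langle\lambda_k,x\rangle\right)$, i.e. the set of points $x\in\mathbb{R}^d$ at which this maximum is attained by at least two distinct indices $k$. *)

(* Defs.v *)
From HB Require Import structures.
From mathcomp Require Import all_boot all_order all_algebra.
From mathcomp Require Import complex.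
From mathcomp Require Import all_classical all_reals all_analysis.

Set Implicit Arguments.
Unset Strict Implicit.
Unset Printing Implicit Defensive.

Import Order.TTheory GRing.Theory Num.Theory.

Local Open Scope classical_set_scope.
Local Open Scope ring_scope.
Local Open Scope complex_scope.

(* Bilinear, without conjugation, also over R[i]. *)
Definition pairing (S : pzRingType) (d : nat) (u v : 'rV[S]_d) : S :=
  \sum_(j < d) u 0 j * v 0 j.

(* The norm `|x| that MathComp-Analysis puts on 'rV[R]_d is the sup norm. *)
Definition eucl_norm (R : realType) (d : nat) (x : 'rV[R]_d) : R :=
  Num.sqrt (\sum_(j < d) x 0 j ^+ 2).

(* The value is +oo when A is empty. *)
Definition eucl_dist (R : realType) (d : nat) (A : set 'rV[R]_d) (x : 'rV[R]_d) :
    \bar R :=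
  ereal_inf [set (eucl_norm (x - y))%:E | y in A].

(* exp (a + ib) = exp a * (cos b + i sin b); the library has no complex
   exponential. *)
Definition cexp (R : realType) (z : R[i]) : R[i] :=
  (expR (complex.Re z))%:C * (cos (complex.Im z) +i* sin (complex.Im z)).

Definition expsum (R : realType) (d n : nat) (c : 'I_n.+1 -> R[i])
    (lam : 'I_n.+1 -> 'rV[R]_d) (z : 'rV[R[i]]_d) : R[i] :=
  \sum_(k < n.+1) c k * cexp (pairing (map_mx (real_complex R) (lam k)) z).

Definition amoeba (R : realType) (d : nat) (f : 'rV[R[i]]_d -> R[i]) :
    set 'rV[R]_d :=
  [set map_mx (@complex.Re R) z | z in [set z | f z = 0]].

(* `|c k| is the modulus seen as an element of R[i], with zero imaginary part. *)
Definition trop_term (R : realType) (d n : nat) (c : 'I_n.+1 -> R[i])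
    (lam : 'I_n.+1 -> 'rV[R]_d) (k : 'I_n.+1) (x : 'rV[R]_d) : R :=
  ln (complex.Re `|c k|) + pairing (lam k) x.

(* Num.max has no neutral element on R; the starting value is one of the terms,
   hence does not affect the maximum. *)
Definition trop_poly (R : realType) (d n : nat) (c : 'I_n.+1 -> R[i])
    (lam : 'I_n.+1 -> 'rV[R]_d) (x : 'rV[R]_d) : R :=
  \big[Num.max/trop_term c lam ord0 x]_(k < n.+1) trop_term c lam k x.

Definition arch_trop (R : realType) (d n : nat) (c : 'I_n.+1 -> R[i])
    (lam : 'I_n.+1 -> 'rV[R]_d) : set 'rV[R]_d :=
  [set x | exists j k : 'I_n.+1, [/\ j != k,
     trop_term c lam j x = trop_poly c lam x &
     trop_term c lam k x = trop_poly c lam x]].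

(* For n >= 1 the starting value is itself the term (ord0, ord_max). *)
Definition min_dist (R : realType) (d n : nat) (lam : 'I_n.+1 -> 'rV[R]_d) : R :=
  \big[Num.min/eucl_norm (lam ord0 - lam ord_max)]_
    (p : 'I_n.+1 * 'I_n.+1 | p.1 != p.2)
    eucl_norm (lam p.1 - lam p.2).

(* Main.v *)
(* Let [k] be a dominant term at [x].  Walking from [x] in the direction
   [lam j - lam k], the tropical variety is met at the latest where the terms
   [j] and [k] cross, so the distance hypothesis gives
     |c_j exp <lam_j, x>| <= |c_k exp <lam_k, x>| exp (- delta |lam_j - lam_k|).
   It remains to see that the sum over all [j] of exp (- delta |lam_j - lam_k|)
   is less than 2, for then the [k]-th term cannot be cancelled by the others.
   Cut R^d into cubes of side mu / sqrt d centred at the lattice points; each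
   cube contains at most one lam_j - lam_k.  Since |v| >= |v|_1 / sqrt d, the sum
   is dominated by a d-fold product of geometric series,
     (1 + 2 q / (1 - q^2))^d   with   q = (2 + sqrt 3)^(- sqrt d),
   and this is less than 2 for every d >= 1. *)
Require Import Defs.
From HB Require Import structures.
From mathcomp Require Import all_boot all_order all_algebra.
From mathcomp Require Import complex ring lra.
From mathcomp Require Import all_classical all_reals all_analysis.

Import Order.TTheory GRing.Theory Num.Theory.

Local Open Scope classical_set_scope.
Local Open Scope ring_scope.
Local Open Scope complex_scope.

Set Implicit Arguments.
Unset Strict Implicit.
Unset Printing Implicit Defensive.

(** * Rational bounds for exponentials, and the numerical inequality *)

Lemma expR_ge_series (R : realType) (x : R) (n : nat) : 0 <= x ->
  \sum_(0 <= i < n) x ^+ i / i`!%:R <= expR x.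
Proof.
move=> x0.
have mono : {homo series (exp_coeff x) : m p / (m <= p)%N >-> m <= p}.
  by apply: nondecreasing_series => i _ _; exact: exp_coeff_ge0.
by have := nondecreasing_cvgn_le mono (is_cvg_series_exp_coeff x) n.
Qed.

Lemma expR_ge_taylor5 (R : realType) (x : R) : 0 <= x ->
  1 + x + x ^+ 2 / 2 + x ^+ 3 / 6 + x ^+ 4 / 24 + x ^+ 5 / 120 <= expR x.
Proof.
move=> /(expR_ge_series 6); apply: le_trans.
rewrite !big_nat_recr //= big_nil !factS fact0 !natrM.
by rewrite le_eqVlt; apply/orP; left; apply/eqP; field.
Qed.

(* Iterating this from [1 + y <= expR y], with [y = x / 2 ^ m], bounds [expR x]
   from below by rationals with small terms. *)
Lemma expR_ge_sqr (R : realType) (a b x : R) :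
  0 <= a -> a <= expR (x / 2) -> b <= a ^+ 2 -> b <= expR x.
Proof.
move=> a0 ax ba; apply: le_trans ba _.
by rewrite [x in expR x](splitr x) expRD expr2 ler_pM.
Qed.

(** A lower bound on [expR (- (261 / 200))] inverts to [expR (261 / 200) <= 305 / 82], and
    [305 / 82 <= 2 + 43 / 25 <= 2 + sqrt 3]. *)
Lemma ln_2_plus_sqrt3_ge (R : realType) : 261 / 200 <= ln (2 + Num.sqrt 3 : R).
Proof.
have r0 : 0 <= Num.sqrt 3 :> R by exact: sqrtr_ge0.
have r2 : Num.sqrt 3 ^+ 2 = 3 :> R by rewrite sqr_sqrtr.
rewrite -ler_expR lnK ?posrE; last by lra.
have : 82 / 305 <= expR (- (261 / 200)) :> R.
  (* Seven halvings, undone by seven squarings; each fraction is rounded just below the square of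
     the previous one. *)
  have := expR_ge1Dx (- (261 / 200) / 2 / 2 / 2 / 2 / 2 / 2 / 2 : R).
  set e := expR _ => he; have {he} : 97 / 98 <= e by lra.
  rewrite /e => {e}.
  move/expR_ge_sqr=> /(_ (193 / 197)) h; have {h} := h ltac:(lra) ltac:(lra).
  move/expR_ge_sqr=> /(_ (191 / 199)) h; have {h} := h ltac:(lra) ltac:(lra).
  move/expR_ge_sqr=> /(_ (152 / 165)) h; have {h} := h ltac:(lra) ltac:(lra).
  move/expR_ge_sqr=> /(_ (185 / 218)) h; have {h} := h ltac:(lra) ltac:(lra).
  move/expR_ge_sqr=> /(_ (193 / 268)) h; have {h} := h ltac:(lra) ltac:(lra).
  move/expR_ge_sqr=> /(_ (14 / 27)) h; have {h} := h ltac:(lra) ltac:(lra).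
  by move/expR_ge_sqr; apply; lra.
have := expRxMexpNx_1 (261 / 200 : R).
have := expR_gt0 (261 / 200 : R).
set a := expR _; set b := expR _ => a0 ab hb.
have ha : a <= 305 / 82 by nra.
have hr : 43 / 25 <= Num.sqrt 3 :> R by nra.
by lra.
Qed.

Lemma expR_lt2 (R : realType) : expR (137 / 200) < 2 :> R.
Proof.
have : 177 / 353 <= expR (- (137 / 200)) :> R.
  have := expR_ge1Dx (- (137 / 200) / 2 / 2 / 2 / 2 / 2 / 2 : R).
  set e := expR _ => he; have {he} : 277 / 280 <= e by lra.
  rewrite /e => {e}.
  move/expR_ge_sqr=> /(_ (367 / 375)) h; have {h} := h ltac:(lra) ltac:(lra).
  move/expR_ge_sqr=> /(_ (363 / 379)) h; have {h} := h ltac:(lra) ltac:(lra).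
  move/expR_ge_sqr=> /(_ (344 / 375)) h; have {h} := h ltac:(lra) ltac:(lra).
  move/expR_ge_sqr=> /(_ (292 / 347)) h; have {h} := h ltac:(lra) ltac:(lra).
  move/expR_ge_sqr=> /(_ (131 / 185)) h; have {h} := h ltac:(lra) ltac:(lra).
  by move/expR_ge_sqr; apply; lra.
have := expRxMexpNx_1 (137 / 200 : R).
have := expR_gt0 (137 / 200 : R).
set a := expR _; set b := expR _ => a0 ab hb.
by nra.
Qed.

(* 261 / 200 and 137 / 200 are just below ln (2 + sqrt 3) and ln 2, and
   67 / 250 is just above 1 / (2 + sqrt 3). *)
Lemma taylor5_ge_sqr (R : realType) (w : R) : 261 / 200 <= w ->
  2 * w ^+ 2 <= (261 / 200) ^+ 2 * (137 / 200 *
   (1 + w + w ^+ 2 / 2 + w ^+ 3 / 6 + w ^+ 4 / 24 + w ^+ 5 / 120 - 67 / 250)).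
Proof.
move=> hw.
have w0 : 0 <= w by lra.
(* The inequality is tightest near [w = 2]. *)
have h0 : 0 <= (w - 2) ^+ 2 by exact: sqr_ge0.
have h1 := mulr_ge0 w0 h0.
have h2 := mulr_ge0 w0 h1.
have h3 := mulr_ge0 w0 h2.
by lra.
Qed.

(** Since [(1 + y)^d <= expR (d * y)], it suffices that [2 d q / (1 - q^2) <= 137 / 200]. Multiplied
    by [expR w = 1 / q], and with [d = (w / L)^2], this becomes an inequality in [w] alone once [L]
    and [q] are replaced by the bounds [261 / 200] and [67 / 250]; all dimensions are thus treated
    at once. *)
Lemma cell_sum_power_lt2 (R : realType) (d : nat) (q : R) : (1 <= d)%N ->
  q = expR (- (Num.sqrt d%:R * ln (2 + Num.sqrt 3))) ->
  q < 1 /\ (1 + 2 * (q / (1 - q ^+ 2))) ^+ d < 2.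
Proof.
move=> d1 qE.
set L : R := ln _ in qE; set w : R := Num.sqrt _ * L in qE.
have Lge : 261 / 200 <= L by exact: ln_2_plus_sqrt3_ge.
have d1R : 1 <= d%:R :> R by rewrite ler1n.
have r1 : 1 <= Num.sqrt d%:R :> R by rewrite -[leLHS]sqrtr1 ler_sqrt.
have wL : L <= w by rewrite /w ler_peMl //; lra.
have w2 : w ^+ 2 = d%:R * L ^+ 2 by rewrite /w exprMn sqr_sqrtr.
have q0 : 0 < q by rewrite qE expR_gt0.
have qw : expR w * q = 1 by rewrite qE expRxMexpNx_1.
have s3 : 433 / 250 <= Num.sqrt 3 :> R.
  have : 0 <= Num.sqrt 3 :> R by exact: sqrtr_ge0.
  have : Num.sqrt 3 ^+ 2 = 3 :> R by rewrite sqr_sqrtr.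
  by nra.
have eL : expR L = 2 + Num.sqrt 3 by rewrite lnK // posrE; lra.
have q_le : q <= 67 / 250.
  have : q <= expR (- L) by rewrite qE ler_expR lerN2.
  by have := expRxMexpNx_1 L; rewrite eL; set e := expR _; nra.
have q1 : q < 1 by lra.
split=> //.
have e5 := @expR_ge_taylor5 R w ltac:(lra).
have pw := @taylor5_ge_sqr R w ltac:(lra).
have key : 2 * d%:R * q <= 137 / 200 * (1 - q ^+ 2).
  have h1 : 2 * d%:R <= 137 / 200 * (expR w - q).
    have a0 : 0 < (261 / 200) ^+ 2 :> R by apply: exprn_gt0; lra.
    rewrite -(ler_pM2l a0); apply: le_trans (_ : 2 * w ^+ 2 <= _).
      have : (261 / 200) ^+ 2 <= L ^+ 2 by apply: lerXn2r; rewrite ?nnegrE; lra.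
      by rewrite w2; nra.
    by apply: le_trans pw _; rewrite ler_pM2l //; lra.
  have := ler_wpM2r (ltW q0) h1.
  by rewrite -mulrA [X in _ <= X]mulrAC; nra.
have g0 : 0 < 1 - q ^+ 2 by nra.
apply: le_lt_trans (expR_lt2 R).
apply: (@le_trans _ _ (expR (2 * (q / (1 - q ^+ 2))) ^+ d)).
  apply: lerXn2r; rewrite ?nnegrE ?expR_ge0 ?expR_ge1Dx //.
  by rewrite addr_ge0 ?mulr_ge0 ?invr_ge0 // ltW.
rewrite -expRM_natl ler_expR.
rewrite (_ : _ * _ = 2 * d%:R * q / (1 - q ^+ 2)); last by ring.
by rewrite ler_pdivrMr.
Qed.

(** * Lattice cells and their weights *)

(* The multiple of [s] nearest to [t], as absolute value and sign; the sign of
   zero is normalised, since otherwise the central cell would be cut in two. *)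
Definition cell (R : realType) (s t : R) : nat * bool :=
  let N := Num.truncn (`|t| / s + 2^-1) in (N, (0 < N)%N && (t < 0)).

(** The cell of the multiple [N + 1] starts [2 N + 1] half-sides away from zero, whence the odd
    exponent. The pair [(0, true)] is no cell and gets weight [0], so the central cell counts
    once. *)
Definition cell_weight (R : realType) (q : R) (c : nat * bool) : R :=
  if c.1 is N.+1 then q ^+ N.*2.+1 else (~~ c.2)%:R.

Lemma cell_itv (R : realType) (s t : R) : 0 < s ->
  s * ((cell s t).1%:R - 2^-1) <= `|t| < s * ((cell s t).1%:R + 2^-1).
Proof.
move=> s0; rewrite /cell /=.
have h0 : 0 <= `|t| / s + 2^-1 by rewrite addr_ge0 ?divr_ge0 // ltW.
have /andP[h1 h2] := truncn_itv h0.
have hs : `|t| / s * s = `|t| by rewrite divfK ?gt_eqF.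
set N := Num.truncn _ in h1 h2 *.
rewrite -[N.+1%:R]natr1 in h2.
set y := `|t| / s in hs h1 h2 *; rewrite -hs.
by rewrite ![s * _]mulrC ler_pM2r // ltr_pM2r //; apply/andP; split; lra.
Qed.

(** Equal multiple and equal sign place [t] and [u] in one interval of length [s]; the strict upper
    end in [cell_itv] makes the inequality strict, as needed against the separation [mu]. *)
Lemma cell_inj (R : realType) (s t u : R) : 0 < s -> cell s t = cell s u ->
  `|t - u| < s.
Proof.
move=> s0 e; have := cell_itv u s0; have := cell_itv t s0.
have : (0 < (cell s u).1)%N && (t < 0) = (0 < (cell s u).1)%N && (u < 0).
  by rewrite -[RHS]/((cell s u).2) -e.
move=> sg; rewrite e => /andP[h1 h2] /andP[h3 h4].
move: sg.
case: (cell s u).1 h1 h2 h3 h4 => [|N] h1 h2 h3 h4.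
  rewrite ltr_norml => _.
  move: (ler_norm t) (ler_norm (- t)) (ler_norm u) (ler_norm (- u)).
  by rewrite !normrN => *; apply/andP; split; lra.
rewrite ltr_norml; case: (ltrP t 0) => ht; case: (ltrP u 0) => hu //= _.
  by rewrite (ltr0_norm hu) (ltr0_norm ht) in h1 h2 h3 h4; apply/andP; split; lra.
by rewrite (ger0_norm hu) (ger0_norm ht) in h1 h2 h3 h4; apply/andP; split; lra.
Qed.

Lemma expR_le_cell_weight (R : realType) (s t b w : R) : 0 < s -> 0 <= b ->
  2 * w <= b * s ->
  expR (- (b * `|t|)) <= cell_weight (expR (- w)) (cell s t).
Proof.
move=> s0 b0 ws.
have := cell_itv t s0.
have : (cell s t).2 = (0 < (cell s t).1)%N && (t < 0) by [].
rewrite /cell_weight; case: (cell s t) => [[|N] b'] /= bE /andP[h _].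
  by rewrite bE expR_le1 oppr_le0 mulr_ge0.
rewrite -expRM_natl ler_expR mulrN lerN2.
apply: le_trans (ler_wpM2l b0 h).
rewrite mulrA -[N.+1%:R]natr1 -[N.*2.+1%:R]natr1 -muln2 natrM.
have -> : N%:R + 1 - 2^-1 = N%:R + 2^-1 :> R by field.
have -> : (N%:R * 2 + 1) * w = 2 * w * (N%:R + 2^-1) by field.
by rewrite ler_wpM2r // addr_ge0.
Qed.

(** The central cell gives [1]; each sign gives a partial sum of [q + q^3 + q^5 + ...], whose limit
    is [q / (1 - q^2)]. *)
Lemma sum_cell_weight (R : realType) (q : R) (M : nat) : 0 <= q -> q < 1 ->
  \sum_(c : 'I_M.+1 * bool) cell_weight q (val c.1, c.2)
    <= 1 + 2 * (q / (1 - q ^+ 2)).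
Proof.
move=> q0 q1.
have g0 : 0 < 1 - q ^+ 2 by nra.
rewrite -(pair_bigA _ (fun (a : 'I_M.+1) b => cell_weight q (val a, b))) /=.
under eq_bigr do rewrite big_bool /cell_weight /=.
rewrite big_ord_recl /= add0r lerD2l.
under eq_bigr do rewrite -mulr2n -mulr_natl.
rewrite -mulr_sumr ler_pM2l // ler_pdivlMr //.
have -> : (\sum_(i < M) q ^+ (val i).*2.+1) * (1 - q ^+ 2) = q * (1 - q ^+ M.*2).
  elim: M => [|m IH]; first by rewrite big_ord0 expr0; ring.
  by rewrite big_ord_recr /= mulrDl IH doubleS !exprS; ring.
by rewrite ler_piMr // gerBl exprn_ge0.
Qed.

(** Indices are determined by the cells of their points, so the sum over [J] is part of the sum over
    all families of [d] cells, which factors as a [d]-th power by distributivity. *)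
Lemma sum_prod_cell_weight (R : realType) (J : finType) (d : nat)
    (s q : R) (p : J -> 'rV[R]_d) :
  0 <= q -> q < 1 ->
  (forall j l, (forall i, cell s (p j 0 i) = cell s (p l 0 i)) -> j = l) ->
  \sum_j \prod_i cell_weight q (cell s (p j 0 i))
    <= (1 + 2 * (q / (1 - q ^+ 2))) ^+ d.
Proof.
move=> q0 q1 inj.
(* A common bound on the cell numbers keeps the set of cells finite. *)
pose M := \max_(a : J * 'I_d) (cell s (p a.1 0%R a.2)).1.
have leM j i : ((cell s (p j 0%R i)).1 < M.+1)%N.
  by rewrite ltnS /M (leq_bigmax (j, i)).
have wt0 c : 0 <= cell_weight q c.
  by rewrite /cell_weight; case: c.1 => [|N]; rewrite ?exprn_ge0.
pose phi j : {ffun 'I_d -> 'I_M.+1 * bool} :=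
  [ffun i => (inord (cell s (p j 0 i)).1, (cell s (p j 0 i)).2)].
have phiE j i : (val (phi j i).1, (phi j i).2) = cell s (p j 0 i).
  by rewrite ffunE; apply: injective_projections => //; apply: inordK; exact: leM.
have phi_inj : injective phi.
  by move=> j l e; apply: inj => i; rewrite -!phiE e.
pose F (f : {ffun 'I_d -> 'I_M.+1 * bool}) :=
  \prod_i cell_weight q (val (f i).1, (f i).2).
have F0 f : 0 <= F f by exact: prodr_ge0.
have -> : \sum_j \prod_i cell_weight q (cell s (p j 0 i)) = \sum_j F (phi j).
  by apply: eq_bigr => j _; apply: eq_bigr => i _; rewrite phiE.
apply: (@le_trans _ _ (\sum_f F f)).
  have <- : \sum_(f in phi @: J) F f = \sum_j F (phi j).
    by rewrite big_imset //= => j l _ _; exact: phi_inj.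
  rewrite [leRHS](bigID (mem (phi @: J))) /= lerDl sumr_ge0 //.
rewrite -(bigA_distr_bigA (fun _ c => cell_weight q (val c.1, c.2))) /=.
rewrite prodr_const card_ord lerXn2r ?nnegrE ?sumr_ge0 //; last exact: sum_cell_weight.
by apply: le_trans (sum_cell_weight M q0 q1); rewrite sumr_ge0.
Qed.

(** * The Euclidean norm and its comparison with coordinates *)

Lemma sqr_eucl_norm (R : realType) (d : nat) (x : 'rV[R]_d) :
  eucl_norm x ^+ 2 = \sum_i x 0 i ^+ 2.
Proof. by rewrite sqr_sqrtr // sumr_ge0 // => i _; exact: sqr_ge0. Qed.

Lemma eucl_norm_ge0 (R : realType) (d : nat) (x : 'rV[R]_d) : 0 <= eucl_norm x.
Proof. exact: sqrtr_ge0. Qed.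

Lemma eucl_norm_gt0 (R : realType) (d : nat) (x : 'rV[R]_d) :
  x != 0 -> 0 < eucl_norm x.
Proof.
move=> x0; rewrite lt_def eucl_norm_ge0 andbT; apply: contra x0.
rewrite -sqrf_eq0 sqr_eucl_norm psumr_eq0; last by move=> i _; exact: sqr_ge0.
move=> /allP x0; apply/eqP/rowP => i; rewrite mxE; apply/eqP.
by have := x0 i (mem_index_enum i); rewrite /= sqrf_eq0.
Qed.

Lemma eucl_normZ (R : realType) (d : nat) (a : R) (x : 'rV[R]_d) :
  eucl_norm (a *: x) = `|a| * eucl_norm x.
Proof.
rewrite /eucl_norm -sqrtr_sqr -sqrtrM ?sqr_ge0 // mulr_sumr.
by congr Num.sqrt; apply: eq_bigr => i _; rewrite mxE exprMn.
Qed.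

Lemma eucl_norm0 (R : realType) (d : nat) : eucl_norm (0 : 'rV[R]_d) = 0.
Proof. by rewrite -(scale0r 0) eucl_normZ normr0 mul0r. Qed.

Lemma sum_normr_le_eucl_norm (R : realType) (d : nat) (x : 'rV[R]_d) :
  \sum_i `|x 0 i| <= Num.sqrt d%:R * eucl_norm x.
Proof.
case: d x => [|d] x; first by rewrite big_ord0 mulr_ge0 ?sqrtr_ge0.
(* Cauchy-Schwarz, from the variance of the [`|x 0 i|]. *)
set S := \sum_i _.
have : 0 <= \sum_i (`|x 0 i| * d.+1%:R - S) ^+ 2.
  by rewrite sumr_ge0 // => i _; exact: sqr_ge0.
have -> : \sum_i (`|x 0 i| * d.+1%:R - S) ^+ 2
    = d.+1%:R * (d.+1%:R * eucl_norm x ^+ 2 - S ^+ 2).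
  transitivity (\sum_i (d.+1%:R ^+ 2 * x 0 i ^+ 2
      - 2 * d.+1%:R * S * `|x 0 i| + S ^+ 2)).
    by apply: eq_bigr => i _; rewrite -[x 0 i ^+ 2]real_normK ?num_real //; ring.
  rewrite big_split sumrB /= -!mulr_sumr -sqr_eucl_norm -/S.
  by rewrite sumr_const card_ord -[_ *+ _]mulr_natl; ring.
rewrite pmulr_rge0 ?ltr0Sn // subr_ge0 => h.
have S0 : 0 <= S by rewrite sumr_ge0.
rewrite -ler_sqr ?nnegrE ?mulr_ge0 ?sqrtr_ge0 //.
by rewrite exprMn sqr_sqrtr ?ler0n.
Qed.

(** Used with [s = mu / sqrt d]: two points in one cell are closer than [mu]. *)
Lemma eucl_norm_lt (R : realType) (d : nat) (s : R) (x : 'rV[R]_d) :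
  (1 <= d)%N -> 0 < s -> (forall i, `|x 0 i| < s) ->
  eucl_norm x < Num.sqrt d%:R * s.
Proof.
move=> d1 s0 xs.
rewrite -ltr_sqr ?nnegrE ?eucl_norm_ge0 ?mulr_ge0 ?sqrtr_ge0 ?(ltW s0) //.
rewrite sqr_eucl_norm exprMn sqr_sqrtr ?ler0n //.
case: d d1 x xs => // d _ x xs.
rewrite -[d.+1%:R]/(d.+1%:R) mulr_natl -[X in _ *+ X](card_ord d.+1) -sumr_const.
apply: ltr_sum => [|i _]; first by apply/hasP; exists ord0; rewrite ?mem_index_enum.
by rewrite -[ltLHS]real_normK ?num_real // ltr_sqr ?nnegrE // ltW.
Qed.

(** * Separated points and sums of decaying exponentials *)

Lemma min_dist_le (R : realType) (d n : nat) (lam : 'I_n.+1 -> 'rV[R]_d)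
    (j k : 'I_n.+1) : j != k -> min_dist lam <= eucl_norm (lam j - lam k).
Proof. by move=> jk; exact: (bigmin_le_cond _ (j := (j, k))). Qed.

Lemma min_dist_gt0 (R : realType) (d n : nat) (lam : 'I_n.+1 -> 'rV[R]_d) :
  (1 <= n)%N -> injective lam -> 0 < min_dist lam.
Proof.
move=> n1 inj.
have pos j k : j != k -> 0 < eucl_norm (lam j - lam k).
  move=> jk; apply: eucl_norm_gt0; rewrite subr_eq0.
  by apply: contra jk => /eqP/inj ->.
apply: (big_ind (fun v => 0 < v)) => [|u v u0 v0|[j k] /=]; last exact: pos.
(* The starting value of the minimum: [ord0] and [ord_max] differ because [n >= 1]. *)
- by apply: pos; rewrite -val_eqE /= neq_ltn n1.
- by rewrite lt_min u0.
Qed.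

Lemma sum_expR_separated_lt2 (R : realType) (d : nat) (J : finType)
    (p : J -> 'rV[R]_d) (mu delta : R) :
  (1 <= d)%N -> 0 < mu ->
  (forall j l, j != l -> mu <= eucl_norm (p j - p l)) ->
  d%:R * Num.sqrt d%:R / mu * 2 * ln (2 + Num.sqrt 3) <= delta ->
  \sum_j expR (- (delta * eucl_norm (p j))) < 2.
Proof.
move=> d1 mu0 sep hdelta.
have [q1 lt2] := cell_sum_power_lt2 d1
  (erefl (expR (- (Num.sqrt (d%:R : R) * ln (2 + Num.sqrt 3))))).
set w := Num.sqrt _ * _ in q1 lt2; set q := expR (- w) in q1 lt2.
apply: le_lt_trans lt2.
set r := Num.sqrt (d%:R : R) in w q q1 *.
have d0 : 0 < d%:R :> R by rewrite ltr0n.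
have r0 : 0 < r by rewrite sqrtr_gt0.
have r2 : r ^+ 2 = d%:R by rewrite sqr_sqrtr // ltW.
(* The side is chosen so that the diagonal [r * s] of a cube is [mu]. *)
pose s := mu / r.
have s0 : 0 < s by rewrite divr_gt0.
have L0 : 0 <= ln (2 + Num.sqrt 3) :> R.
  by rewrite ln_ge0 //; have := sqrtr_ge0 (3 : R); lra.
have delta0 : 0 <= delta.
  by apply: le_trans hdelta; rewrite !mulr_ge0 ?invr_ge0 // ltW.
have inj j l : (forall i, cell s (p j 0 i) = cell s (p l 0 i)) -> j = l.
  move=> e; apply/eqP/negPn/negP => /sep; apply/negP; rewrite -ltNge.
  have -> : mu = r * s by rewrite /s mulrC divfK // gt_eqF.
  apply: eucl_norm_lt => // i; rewrite !mxE; exact: cell_inj (e i).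
apply: le_trans (sum_prod_cell_weight (expR_ge0 _) q1 inj).
apply: ler_sum => j _.
apply: (@le_trans _ _ (\prod_i expR (- (delta / r * `|p j 0 i|)))).
  rewrite -expR_sum ler_expR sumrN lerN2 -mulr_sumr.
  apply: le_trans (ler_wpM2l _ (sum_normr_le_eucl_norm (p j))) _.
    by rewrite divr_ge0 // ltW.
  by rewrite mulrA divfK ?gt_eqF.
apply: ler_prod => i _; rewrite expR_ge0 /=.
apply: expR_le_cell_weight => //; first by rewrite divr_ge0 // ltW.
(* The bound on [delta], multiplied by [mu / d], is exactly [2 * w <= delta / r * s]. *)
have -> : 2 * w = (d%:R * r / mu * 2 * ln (2 + Num.sqrt 3)) * (mu / d%:R).
  by rewrite /w; field; rewrite !gt_eqF.
have -> : delta / r * s = delta * (mu / d%:R).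
  by rewrite /s -r2; field; rewrite !gt_eqF.
by rewrite ler_pM2r // divr_gt0.
Qed.

(** * The tropical polynomial along a ray *)

Lemma pairingDZr (R : realType) (d : nat) (u x p : 'rV[R]_d) (s : R) :
  pairing u (x + s *: p) = pairing u x + s * pairing u p.
Proof.
rewrite /pairing mulr_sumr -big_split /=.
by apply: eq_bigr => i _; rewrite !mxE; ring.
Qed.

Lemma pairing_subl (R : realType) (d : nat) (u v x : 'rV[R]_d) :
  pairing (u - v) x = pairing u x - pairing v x.
Proof.
by rewrite /pairing -sumrB; apply: eq_bigr => i _; rewrite !mxE mulrBl.
Qed.

Lemma pairing_self (R : realType) (d : nat) (u : 'rV[R]_d) :
  pairing u u = eucl_norm u ^+ 2.
Proof. by rewrite sqr_eucl_norm; apply: eq_bigr => i _; rewrite expr2. Qed.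

Lemma trop_term_line (R : realType) (d n : nat) (c : 'I_n.+1 -> R[i])
    (lam : 'I_n.+1 -> 'rV[R]_d) (k : 'I_n.+1) (x p : 'rV[R]_d) (s : R) :
  trop_term c lam k (x + s *: p) = trop_term c lam k x + s * pairing (lam k) p.
Proof. by rewrite /trop_term pairingDZr addrA. Qed.

Lemma trop_poly_max (R : realType) (d n : nat) (c : 'I_n.+1 -> R[i])
    (lam : 'I_n.+1 -> 'rV[R]_d) (k : 'I_n.+1) (x : 'rV[R]_d) :
  (forall j, trop_term c lam j x <= trop_term c lam k x) ->
  trop_poly c lam x = trop_term c lam k x.
Proof.
move=> kmax; apply/le_anti/andP; split; first exact: bigmax_le.
exact: le_bigmax.
Qed.

(** Along the ray [x + s p] the gap between the terms [k] and [l] shrinks at rate [slope l]; for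
    [l = j] this rate is [|p|^2 > 0], so some term does catch up with [k]. *)
Lemma trop_term_gap (R : realType) (d n : nat) (c : 'I_n.+1 -> R[i])
    (lam : 'I_n.+1 -> 'rV[R]_d) (delta : R) (x : 'rV[R]_d) (j k : 'I_n.+1) :
  injective lam -> (delta%:E <= eucl_dist (arch_trop c lam) x)%E ->
  (forall l, trop_term c lam l x <= trop_term c lam k x) ->
  trop_term c lam j x <= trop_term c lam k x - delta * eucl_norm (lam j - lam k).
Proof.
move=> inj hx kmax.
have [-> | jk] := eqVneq j k.
  by rewrite subrr eucl_norm0 mulr0 subr0.
set p := lam j - lam k.
have p0 : 0 < eucl_norm p.
  by apply: eucl_norm_gt0; rewrite subr_eq0; apply: contra jk => /eqP/inj ->.
pose gap l := trop_term c lam k x - trop_term c lam l x.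
pose slope l := pairing (lam l) p - pairing (lam k) p.
have gap0 l : 0 <= gap l by rewrite subr_ge0.
have slopej : slope j = eucl_norm p ^+ 2 by rewrite /slope -pairing_subl pairing_self.
have sj0 : 0 < slope j by rewrite slopej exprn_gt0.
(* [i] is the first term to catch up with [k] on the ray from [x]. *)
case: (@arg_minP _ _ _ j (fun l => 0 < slope l) (fun l => gap l / slope l) sj0).
move=> i si0 imin.
set t := gap i / slope i in imin.
have t0 : 0 <= t by rewrite divr_ge0 // ltW.
pose y := x + t *: p.
have kmaxy l : trop_term c lam l y <= trop_term c lam k y.
  rewrite !trop_term_line -subr_ge0.
  have -> : trop_term c lam k x + t * pairing (lam k) p
      - (trop_term c lam l x + t * pairing (lam l) p) = gap l - t * slope l.
    by rewrite /gap /slope; ring.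
  (* Terms of nonpositive slope never overtake [k]; the others do not before [t], by minimality of
     [i]. *)
  have [sl0|sl0] := ltrP 0 (slope l); last first.
    by rewrite subr_ge0 (le_trans _ (gap0 l)) // mulr_ge0_le0.
  by rewrite subr_ge0 -ler_pdivlMr // imin.
have yT : arch_trop c lam y.
  exists i, k; rewrite (trop_poly_max kmaxy); split=> //.
    by apply: contraTneq si0 => ->; rewrite /slope subrr ltxx.
  rewrite !trop_term_line; have : t * slope i = gap i by rewrite divfK ?gt_eqF.
  by rewrite /slope /gap mulrBr => e; lra.
have : delta <= eucl_norm (x - y).
  by rewrite -lee_fin (le_trans hx) //; apply: ereal_inf_lbound; exists y.
rewrite (_ : x - y = - t *: p); last by rewrite /y opprD addNKr scaleNr.
rewrite eucl_normZ normrN ger0_norm // => hd.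
(* Minimality gives [t |p|^2 <= gap j], and the distance from [x] to [y] gives [delta <= t |p|]. *)
have := imin j sj0; rewrite slopej ler_pdivlMr ?exprn_gt0 // => tj.
rewrite lerBrDr -lerBrDl -/(gap j).
by apply: le_trans tj; rewrite expr2 mulrA ler_pM2r.
Qed.

(** * Moduli of the terms and the vanishing sum *)

Lemma Re_pairing (R : realType) (d : nat) (u : 'rV[R]_d) (z : 'rV[R[i]]_d) :
  complex.Re (pairing (map_mx (real_complex R) u) z) =
  pairing u (map_mx (@complex.Re R) z).
Proof.
rewrite /pairing raddf_sum; apply: eq_bigr => i _; rewrite !mxE.
by case: (z 0 i) => a b /=; rewrite mul0r subr0.
Qed.

Lemma normc_cexp (R : realType) (z : R[i]) :
  Normc.normc (cexp z) = expR (complex.Re z).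
Proof.
rewrite /cexp Normc.normcM /= cos2Dsin2 sqrtr1 mulr1 expr0n addr0 sqrtr_sqr.
by rewrite ger0_norm ?expR_ge0.
Qed.

Lemma expR_trop_term (R : realType) (d n : nat) (c : 'I_n.+1 -> R[i])
    (lam : 'I_n.+1 -> 'rV[R]_d) (k : 'I_n.+1) (z : 'rV[R[i]]_d) :
  c k != 0 ->
  expR (trop_term c lam k (map_mx (@complex.Re R) z)) =
  Normc.normc (c k * cexp (pairing (map_mx (real_complex R) (lam k)) z)).
Proof.
move=> ck0; rewrite Normc.normcM normc_cexp Re_pairing expRD lnK //.
(* Positivity of the argument of [ln] is transferred to [R[i]], where that argument is the norm of
   [c k]. *)
by rewrite posrE -ltcR /= -[X in _ < X]/(`|c k|) normr_gt0.
Qed.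

Unset Implicit Arguments.

Theorem theorem1p3 (R : realType) (d n : nat) (hd : (1 <= d)%N) (hn : (1 <= n)%N)
    (c : 'I_n.+1 -> R[i]) (lam : 'I_n.+1 -> 'rV[R]_d)
    (hc : forall k, c k != 0) (hlam : injective lam)
    (delta : R)
    (hdelta : d%:R * Num.sqrt d%:R / min_dist lam * 2 * ln (2 + Num.sqrt 3) <= delta)
    (x : 'rV[R]_d)
    (hx : (delta%:E <= eucl_dist (arch_trop c lam) x)%E) :
  (~` amoeba (expsum c lam)) x.
Proof.
move=> [z fz0 zx].
have [k _ kmax] := @arg_maxP _ _ _ (ord0 : 'I_n.+1) predT
  (fun k => trop_term c lam k x) isT.
have {}kmax l : trop_term c lam l x <= trop_term c lam k x by exact: kmax.
pose u l := c l * cexp (pairing (map_mx (real_complex R) (lam l)) z).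
have uE l : Normc.normc (u l) = expR (trop_term c lam l x).
  by rewrite -zx expR_trop_term.
have sep j l : j != l ->
    min_dist lam <= eucl_norm ((lam j - lam k) - (lam l - lam k)).
  by move=> jl; rewrite opprB addrA subrK; exact: min_dist_le.
have := sum_expR_separated_lt2 hd (min_dist_gt0 hn hlam) sep hdelta.
(* The index [k] contributes [1], so the others sum to less than [1]; the vanishing of the sum at
   [z] refutes this. *)
rewrite (bigD1 k) //= subrr eucl_norm0 mulr0 oppr0 expR0 -ltrBrDl.
rewrite (_ : 2 - 1 = 1 :> R); last by ring.
(* Scaled by the modulus of [u k], the claim is that this modulus is at most the sum of the gap
   bounds for the other terms. *)
apply/negP; rewrite -leNgt -(ler_pM2l (expR_gt0 (trop_term c lam k x))) mulr1.
have uk : u k = - \sum_(j | j != k) u j.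
  apply/eqP; rewrite -addr_eq0; apply/eqP.
  by move: fz0; rewrite /= /expsum (bigD1 k).
rewrite -[leLHS]uE uk normcN.
apply: (@le_trans _ _ (\sum_(j | j != k) Normc.normc (u j))).
  elim/big_ind2: _ => [|a a' b b' ha hb|//]; first by rewrite Normc.normc0.
  by apply: le_trans (le_normcD _ _) _; exact: lerD.
rewrite mulr_sumr; apply: ler_sum => j _; rewrite uE -expRD ler_expR.
exact: trop_term_gap.
Qed.
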